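(* Let $p,q\in(M,\tau)$ be Hermitian and freely independent with $\mu_p=a\delta_\alpha+(1-a)\delta_{\alpha'}$, $\mu_q=b\delta_\beta+(1-b)\delta_{\beta'}$, where $a,b\in(0,1)$, $\alpha,\alpha',\beta,\beta'\in\mathbb{R}$, $\alpha\ne\alpha'$, $\beta\ne\beta'$. Let $\nu=\nu_{a,b}$ be the probability measure on $(0,\pi/2)$ defined in the context. Then: 1. Swapping the roles of $p$ and $q$ fixes $\nu$, i.e. $\nu_{b,a}=\nu_{a,b}$. 2. Changing one of $a\mapsto1-a$ or $b\mapsto1-b$ changes $\nu$ by the map $\theta\mapsto\pi/2-\theta$; i.e. $\nu_{1-a,b}$ and $\nu_{a,1-b}$ are both equal to the pushforward of $\nu_{a,b}$ under $\theta\mapsto\pi/2-\theta$. These changes correspond to changing $p\mapsto\alpha+\alpha'-p$ and $q\mapsto\beta+\beta'-q$, respectively. 3. Changing both $a\mapsto1-a$ and $b\mapsto1-b$ fixes $\nu$, i.e. $\nu_{1-a,1-b}=\nu_{a,b}$. This corresponds to changing both $p\mapsto\alpha+\alpha'-p$ and $q\mapsto\beta+\beta'-q$, which amounts to changing $p+iq\mapsto(\alpha+\alpha')+i(\beta+\beta')-(p+iq)$.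
   Context: $(M,\tau)$ is a von Neumann algebra with a faithful, normal, tracial state $\tau$. For Hermitian $y\in M$, $\mu_y$ is its spectral measure with respect to $\tau$. For $a,b\in(0,1)$, $\nu_{a,b}$ is the probability measure on $(0,\pi/2)$ with density with respect to Lebesgue measure $$\frac{d\nu_{a,b}}{d\theta}=\frac{2}{\pi\,\epsilon}\operatorname{Im}\left(\sqrt{f(\sec^2\theta)}\right)\cot\theta,$$ where $f(x)=1+(4ab-2(a+b))x+(a-b)^2x^2$, the square root of a negative number is on the positive imaginary axis, and $\epsilon=1-\max(0,a+b-1)-\max(0,a+(1-b)-1)-\max(0,(1-a)+b-1)-\max(0,(1-a)+(1-b)-1)$, which is positive. (This $\nu_{a,b}$ is the measure that enters the formula for the Brown measure of $p+iq$.) ''Corresponds to'' means that the indicated replacement of operators keeps the atoms' positions and effects the indicated change of weights in the laws $\mu_p=a\delta_\alpha+(1-a)\delta_{\alpha'}$, $\mu_q=b\delta_\beta+(1-b)\delta_{\beta'}$. *)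

(* Defs.v *)
From HB Require Import structures.
From mathcomp Require Import all_boot all_order all_algebra sesquilinear.
From mathcomp Require Import complex.
From mathcomp Require Import all_classical all_reals all_analysis.

Set Implicit Arguments.
Unset Strict Implicit.
Unset Printing Implicit Defensive.

Import Order.TTheory GRing.Theory Num.Theory.
Import numFieldNormedType.Exports.

Local Open Scope classical_set_scope.
Local Open Scope ring_scope.
Local Open Scope complex_scope.

(* A complex Hilbert space is a complete normed space [H] over [R[i]] whose norm
   is induced by [ip].  The form is linear in its first argument and
   conjugate-linear in its second one. *)
Definition hilbert_inner_product (R : realType)
    (H : completeNormedModType R[i]) (ip : {dot H for Num.conj}) : Prop :=
  forall x : H, ip x x = `|x| ^+ 2.

Definition bounded_operator (R : realType) (H : completeNormedModType R[i])
    (S : H -> H) : Prop :=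
  linear S /\ exists k : R[i], forall x : H, `|S x| <= k * `|x|.

Definition adjoint (R : realType) (H : completeNormedModType R[i])
    (ip : {dot H for Num.conj}) (S S' : H -> H) : Prop :=
  forall x y : H, ip (S x) y = ip x (S' y).

Definition hermitian_operator (R : realType) (H : completeNormedModType R[i])
    (ip : {dot H for Num.conj}) (S : H -> H) : Prop :=
  adjoint ip S S.

(* The order of [R[i]] is partial: [u <= v] says that [v - u] is real and
   nonnegative. *)
Definition operator_le (R : realType) (H : completeNormedModType R[i])
    (ip : {dot H for Num.conj}) (S T : H -> H) : Prop :=
  forall x : H, ip (S x) x <= ip (T x) x.

Definition commutant (R : realType) (H : completeNormedModType R[i])
    (A : set (H -> H)) : set (H -> H) :=
  [set T | bounded_operator T /\ forall S, A S -> T \o S = S \o T].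

Record von_neumann_algebra (R : realType) (H : completeNormedModType R[i])
    (ip : {dot H for Num.conj}) (M : set (H -> H)) : Prop := {
  vna_bounded : forall S, M S -> bounded_operator S;
  vna_adjoint : forall S S', M S -> adjoint ip S S' -> M S';
  vna_bicommutant : commutant (commutant M) = M }.

(* Normality: [tau] preserves suprema of nonempty, upward directed, bounded sets
   of Hermitian elements (the supremum [s] is taken among the Hermitian elements
   of [M]). *)
Definition normal_functional (R : realType) (H : completeNormedModType R[i])
    (ip : {dot H for Num.conj}) (M : set (H -> H)) (tau : (H -> H) -> R[i])
    : Prop :=
  forall (D : set (H -> H)) (s : H -> H),
    D `<=` [set S | M S /\ hermitian_operator ip S] ->
    D !=set0 ->
    (forall S T, D S -> D T ->
       exists U, [/\ D U, operator_le ip S U & operator_le ip T U]) ->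
    M s -> hermitian_operator ip s ->
    (forall S, D S -> operator_le ip S s) ->
    (forall u, M u -> hermitian_operator ip u ->
       (forall S, D S -> operator_le ip S u) -> operator_le ip s u) ->
    supremums (tau @` D) (tau s).

(* Only the values of [tau] on [M] matter. *)
Record faithful_normal_tracial_state (R : realType)
    (H : completeNormedModType R[i]) (ip : {dot H for Num.conj})
    (M : set (H -> H)) (tau : (H -> H) -> R[i]) : Prop := {
  state_linear : forall (c : R[i]) S T, M S -> M T ->
    tau (c *: S + T) = c * tau S + tau T;
  state_unit : tau idfun = 1;
  state_positive : forall S S', M S -> adjoint ip S S' -> 0 <= tau (S' \o S);
  state_faithful : forall S S', M S -> adjoint ip S S' ->
    tau (S' \o S) = 0 -> S = 0;
  state_normal : normal_functional ip M tau;
  state_tracial : forall S T, M S -> M T -> tau (S \o T) = tau (T \o S) }.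

Record unital_star_subalgebra (R : realType) (H : completeNormedModType R[i])
    (ip : {dot H for Num.conj}) (A : set (H -> H)) : Prop := {
  star_unit : A idfun;
  star_linear : forall (c : R[i]) S T, A S -> A T -> A (c *: S + T);
  star_mul : forall S T, A S -> A T -> A (S \o T);
  star_adjoint : forall S S', A S -> adjoint ip S S' -> A S' }.

Definition generated_star_algebra (R : realType)
    (H : completeNormedModType R[i]) (ip : {dot H for Num.conj}) (S : H -> H)
    : set (H -> H) :=
  smallest (unital_star_subalgebra ip) [set S].

Definition free_subalgebras (R : realType) (H : completeNormedModType R[i])
    (tau : (H -> H) -> R[i]) (I : eqType) (A : I -> set (H -> H)) : Prop :=
  forall (n : nat) (i : nat -> I) (x : nat -> H -> H),
    (forall k, (k <= n)%N -> A (i k) (x k) /\ tau (x k) = 0) ->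
    (forall k, (k < n)%N -> i k != i k.+1) ->
    tau (\big[(fun S T : H -> H => S \o T)/idfun]_(k < n.+1) x k) = 0.

Definition freely_independent (R : realType) (H : completeNormedModType R[i])
    (ip : {dot H for Num.conj}) (tau : (H -> H) -> R[i]) (p q : H -> H)
    : Prop :=
  free_subalgebras tau
    (fun i : bool => generated_star_algebra ip (if i then p else q)).

(* [E] is the projection-valued spectral measure of [y]:
   y = \int lambda dE(lambda). *)
Record spectral_resolution (R : realType) (H : completeNormedModType R[i])
    (ip : {dot H for Num.conj}) (M : set (H -> H)) (y : H -> H)
    (E : set (measurableTypeR R) -> H -> H) : Prop := {
  resolution_mem : forall B, measurable B -> M (E B);
  resolution_hermitian : forall B, measurable B -> hermitian_operator ip (E B);
  resolution_mul : forall B C, measurable B -> measurable C ->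
    E (B `&` C) = E B \o E C;
  resolution_unit : E setT = idfun;
  resolution_compact : exists r : R, E [set t : R | - r <= t <= r] = idfun;
  resolution_integral : forall x : H,
    exists m : {finite_measure set (measurableTypeR R) -> \bar R},
      (forall B, measurable B -> m B = (complex.Re (ip (E B x) x))%:E) /\
      ip (y x) x = (Rintegral m setT (fun t : measurableTypeR R => t : R))%:C }.

(* mu = mu_y, where mu_y = tau \o E for the spectral resolution [E] of [y]. *)
Definition spectral_law (R : realType) (H : completeNormedModType R[i])
    (ip : {dot H for Num.conj}) (M : set (H -> H)) (tau : (H -> H) -> R[i])
    (y : H -> H) (mu : set (measurableTypeR R) -> \bar R) : Prop :=
  exists E : set (measurableTypeR R) -> H -> H,
    spectral_resolution ip M y E /\
    forall B, measurable B -> mu B = (complex.Re (tau (E B)))%:E.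

Definition two_atoms (R : realType) (a x x' : R)
    (B : set (measurableTypeR R)) : \bar R :=
  (a%:E * \d_(x : measurableTypeR R) B
   + (1 - a)%:E * \d_(x' : measurableTypeR R) B)%E.

Record free_two_atom_pair (R : realType) (H : completeNormedModType R[i])
    (ip : {dot H for Num.conj}) (M : set (H -> H)) (tau : (H -> H) -> R[i])
    (a alpha alpha' b beta beta' : R) (p q : H -> H) : Prop := {
  pair_mem_l : M p;
  pair_mem_r : M q;
  pair_hermitian_l : hermitian_operator ip p;
  pair_hermitian_r : hermitian_operator ip q;
  pair_free : freely_independent ip tau p q;
  pair_law_l : spectral_law ip M tau p (two_atoms a alpha alpha');
  pair_law_r : spectral_law ip M tau q (two_atoms b beta beta') }.

Definition scalar_operator (R : realType) (H : completeNormedModType R[i])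
    (c : R[i]) : H -> H :=
  c *: idfun.
Arguments scalar_operator {R} H c.

Definition nu_f (R : realType) (a b x : R) : R :=
  1 + (4 * a * b - 2 * (a + b)) * x + (a - b) ^+ 2 * x ^+ 2.

Definition nu_epsilon (R : realType) (a b : R) : R :=
  1 - Num.max 0 (a + b - 1) - Num.max 0 (a + (1 - b) - 1)
    - Num.max 0 ((1 - a) + b - 1) - Num.max 0 ((1 - a) + (1 - b) - 1).

(* [sqrtc] maps a negative real to the positive imaginary axis. *)
Definition nu_density (R : realType) (a b theta : R) : R :=
  2 / (pi * nu_epsilon a b)
    * complex.Im (sqrtc (nu_f a b ((cos theta)^-1 ^+ 2))%:C)
    * (cos theta / sin theta).

(* The measure on (0, pi/2) is viewed as a Borel measure on the line. *)
Definition nu (R : realType) (a b : R) (B : set (measurableTypeR R)) : \bar R :=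
  (\int[@lebesgue_measure R]_(theta in B `&` `]0%R, (pi / 2)%R[)
     (nu_density a b theta)%:E)%E.

Definition reflect_angle (R : realType) (theta : measurableTypeR R)
    : measurableTypeR R :=
  pi / 2 - theta.

(* Main.v *)
Require Import Defs.
From HB Require Import structures.
From mathcomp Require Import all_boot all_order all_algebra sesquilinear.
From mathcomp Require Import complex.
From mathcomp Require Import all_classical all_reals all_analysis measurable_realfun.
From mathcomp Require Import ring lra.

(** Operators and angles are transformed by reflections [t |-> c - t].

    On the side of the measures, put [x = cos^2 theta] and [y = sin^2 theta], so
    that [x + y = 1] and [f] is evaluated at [1/x].  Clearing denominators,
    [x^2 f_{a,b}(1/x)] is the quadratic polynomial
    [x^2 + (4ab - 2(a+b)) x + (a-b)^2], and substituting [1 - x] for [x] in it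
    gives exactly the polynomial of [(1-a, b)]; this is [nu_f_flip].  Taking imaginary
    parts of square roots, [cos^2 theta] times the root for [(1-a, b)] at [theta]
    equals [sin^2 theta] times the root for [(a, b)] at [pi/2 - theta], and the
    ratio [sin^2/cos^2] turns the cotangent at [theta] into the cotangent at
    [pi/2 - theta].  So the densities match pointwise ([nu_density_flip]), and
    invariance of Lebesgue measure under reflections ([ge0_integral_reflect])
    turns this into the equality of measures ([nu_flip]).  The symmetries
    [(a, b) |-> (b, a)] and [(a, b) |-> (1-a, 1-b)] leave [f] and [epsilon], hence
    the density, unchanged.

    On the side of the operators, let [c = alpha + alpha'].  If [E] is the
    spectral measure of [p], then [B |-> E (c - B)] is that of [c - p]
    ([spectral_resolution_reflect]), so the law of [c - p] is the image of the law
    of [p] under [t |-> c - t]; this exchanges [alpha] and [alpha'], that is, it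
    keeps the atoms and exchanges their weights.  Freeness is not affected because
    [c - p] and [p] generate the same unital star-algebra
    ([generated_scalar_sub]). *)

Set Implicit Arguments.
Unset Strict Implicit.
Unset Printing Implicit Defensive.

Import Order.TTheory GRing.Theory Num.Theory.
Import numFieldNormedType.Exports.

Local Open Scope classical_set_scope.
Local Open Scope ring_scope.
Local Open Scope complex_scope.

(** * Affine reflections of an operator *)

Section ScalarSub.
Variables (R : realType) (H : completeNormedModType R[i])
  (ip : {dot H for Num.conj}).
Implicit Types (A M : set (H -> H)) (y : H -> H).

Lemma scalar_sub_apply (c : R[i]) y x :
  (scalar_operator H c - y) x = c *: x - y x.
Proof. by []. Qed.

Lemma bounded_scalar_sub (c : R[i]) y :
  bounded_operator y -> bounded_operator (scalar_operator H c - y).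
Proof.
move=> [ly [k yk]]; split.
  move=> a u v; rewrite !scalar_sub_apply ly scalerDr scalerBr !scalerA.
  by rewrite opprD addrACA (mulrC c).
exists (`|c| + k) => x; rewrite scalar_sub_apply mulrDl.
by apply: (le_trans (ler_normB _ _)); rewrite normrZ lerD2l.
Qed.

(** Being its own bicommutant, [M] contains every bounded operator commuting
    with the commutant; scalars do, since the operators there are linear. *)
Lemma vna_scalar_sub M (c : R[i]) y :
  von_neumann_algebra ip M -> M y -> M (scalar_operator H c - y).
Proof.
move=> hM My; rewrite -(vna_bicommutant hM); split.
  exact: bounded_scalar_sub (vna_bounded hM My).
move=> S [[lS _] SM]; apply/funext => x /=.
have SyE : S (y x) = y (S x) by have /(congr1 (@^~ x)) := SM y My.
have S0 : S 0 = 0 by have := lS (-1) 0 0; rewrite !scaleN1r !addNr.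
have SZ d u : S (d *: u) = d *: S u by rewrite -[d *: u]addr0 lS S0 addr0.
rewrite !scalar_sub_apply -SyE; have := lS (-1) (y x) (c *: x).
by rewrite SZ !scaleN1r ![- _ + _]addrC => ->.
Qed.

Lemma hermitian_scalar_sub (c : R) y :
  hermitian_operator ip y ->
  hermitian_operator ip (scalar_operator H c%:C - y).
Proof.
move=> hy u v; rewrite !scalar_sub_apply linearBl linearBr.
rewrite linearZl_LR linearZr_LR; congr (_ - _); last exact: hy.
by congr (_ * _); apply/esym/conj_Creal; apply/complex_realP; exists c.
Qed.

Lemma star_scalar_sub A (c : R[i]) y :
  unital_star_subalgebra ip A -> A y -> A (scalar_operator H c - y).
Proof.
move=> hA Ay.
(* [c - y = (-1) y + ((c - 1) 1 + 1)] only uses the closure properties of a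
   unital star-subalgebra. *)
have := star_linear hA (-1) Ay
  (star_linear hA (c - 1) (star_unit hA) (star_unit hA)).
congr A; rewrite scaleN1r addrC; congr (_ - _).
by rewrite scalerBl scale1r subrK.
Qed.

(** One inclusion gives the other one, because [y |-> c - y] is an
    involution. *)
Lemma generated_scalar_sub (c : R[i]) y :
  generated_star_algebra ip (scalar_operator H c - y) =
  generated_star_algebra ip y.
Proof.
have sub z : generated_star_algebra ip (scalar_operator H c - z) `<=`
    generated_star_algebra ip z.
  move=> S SG A [hA zA]; apply: SG; split => // _ ->.
  exact: star_scalar_sub hA (zA _ erefl).
apply/seteqP; split; first exact: sub.
by rewrite -{1}(subKr (scalar_operator H c) y).
Qed.

Lemma freely_independent_sym (tau : (H -> H) -> R[i]) (p q : H -> H) :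
  freely_independent ip tau p q -> freely_independent ip tau q p.
Proof.
move=> hpq n i x hx hi; apply: (hpq n (negb \o i)) => k kn /=.
  by have [xA x0] := hx k kn; split => //; case: (i k) xA.
by rewrite (inj_eq negb_inj); exact: hi.
Qed.

End ScalarSub.

(** * Measures under reflections of the line *)

Section ReflectedMeasure.
Variables (R : realType) (c : R).

Definition reflect_line (t : measurableTypeR R) : measurableTypeR R := c - t.

Lemma reflect_lineK : involutive reflect_line.
Proof. by move=> t; rewrite /reflect_line subKr. Qed.

Lemma measurable_reflect_line : measurable_fun setT reflect_line.
Proof. exact: measurable_funB. Qed.

Lemma measurable_reflect_preimage (B : set (measurableTypeR R)) :
  measurable B -> measurable (reflect_line @^-1` B).
Proof.
move=> mB; rewrite -[X in measurable X]setTI.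
exact: measurable_reflect_line.
Qed.

Lemma lebesgue_measure_reflect (A : set (measurableTypeR R)) :
  measurable A ->
  pushforward (@lebesgue_measure R) reflect_line A = lebesgue_measure A.
Proof.
move=> mA; apply/esym/lebesgue_measure_unique => //=.
  exact: measurable_reflect_line.
move=> mf _ [[a b]] _ <-; rewrite /pushforward.
rewrite (_ : _ @^-1` _ = `[c - b, c - a[%classic); last first.
  apply/seteqP; split => t /=; rewrite /reflect_line !in_itv /= => /andP[h1 h2].
    by apply/andP; split; lra.
  by apply/andP; split; lra.
rewrite !lebesgue_measure_itv /= !lte_fin ltrD2l ltrN2.
by case: ifP => // _; congr (_%:E); ring.
Qed.

Lemma ge0_integral_reflect (D : set (measurableTypeR R))
    (f : measurableTypeR R -> \bar R) :
  measurable D -> measurable_fun D f -> (forall t, D t -> (0 <= f t)%E) ->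
  (\int[@lebesgue_measure R]_(t in reflect_line @^-1` D) f (reflect_line t) =
   \int[@lebesgue_measure R]_(t in D) f t)%E.
Proof.
move=> mD mf f0.
rewrite -(ge0_integral_pushforward measurable_reflect_line) //; last first.
  by move=> t; rewrite inE; exact: f0.
apply: eq_measure_integral => [|mr A mA _].
  exact: measurable_reflect_line.
exact: lebesgue_measure_reflect.
Qed.

Variable m : {finite_measure set (measurableTypeR R) -> \bar R}.

(** A constant for the pushforward, so that the finite measure structure is
    attached once, without carrying the measurability of the reflection. *)
Definition reflected_measure : set (measurableTypeR R) -> \bar R :=
  pushforward m reflect_line.

HB.instance Definition _ := Measure.copy reflected_measure
  (measure_function_pushforward__canonical__measure_function_Measure m
     measurable_reflect_line).

Let finite : fin_num_fun reflected_measure.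
Proof.
by move=> A mA; apply: fin_num_measure; exact: measurable_reflect_preimage.
Qed.

HB.instance Definition _ :=
  Measure_isFinite.Build _ _ _ reflected_measure finite.

Let line_id : measurableTypeR R -> R := fun t => t.

(** A finite measure may have no first moment; the spectral measures of interest
    have one because they live on a compact interval. *)
Lemma integrable_id_bounded_support (r : R) :
  m (~` [set t : R | - r <= t <= r]) = 0%E ->
  m.-integrable setT (EFin \o line_id).
Proof.
move=> m0; set K := [set t : R | - r <= t <= r] in m0.
have mK : measurable (K : set (measurableTypeR R)).
  by rewrite (_ : K = `[- r, r]%classic) // set_itvcc.
apply/(negligible_integrable (measurableC mK) measurableT) => //.
  by apply/measurable_EFinP; exact: measurable_id.
rewrite setDE setTI setCK; apply: measurable_bounded_integrable => //.
- by rewrite ltey_eq fin_num_measure.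
- exact: measurable_id.
- exists `|r|; split; first exact: num_real.
  move=> x rx t; rewrite /K /= -ler_norml => tr.
  by rewrite (le_trans tr) // (le_trans (ler_norm r)) // ltW.
Qed.

Lemma Rintegral_reflected_measure :
  m.-integrable setT (EFin \o line_id) ->
  Rintegral reflected_measure setT line_id =
  c * fine (m setT) - Rintegral m setT line_id.
Proof.
move=> mi.
have ci : m.-integrable setT (EFin \o cst c).
  apply: measurable_bounded_integrable => //.
    by rewrite ltey_eq fin_num_measure.
  exact: bounded_cst.
rewrite -Rintegral_cst // -RintegralB // /Rintegral.
rewrite (integral_pushforward measurable_reflect_line) //.
- by apply/measurable_EFinP; exact: measurable_id.
- rewrite preimage_setT.
  rewrite (_ : _ \o _ = (EFin \o cst c) \- (EFin \o line_id))%E //.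
  exact: integrableB.
Qed.

End ReflectedMeasure.

(** * Spectral laws of reflected operators *)

Section ReflectedLaw.
Variables (R : realType) (H : completeNormedModType R[i])
  (ip : {dot H for Num.conj}) (M : set (H -> H)).
Hypotheses (hH : hilbert_inner_product ip) (hM : von_neumann_algebra ip M).

Let K (r : R) : set (measurableTypeR R) := [set t : R | - r <= t <= r].

Let measurable_K r : measurable (K r).
Proof. by rewrite (_ : K r = `[- r, r]%classic) // set_itvcc. Qed.

(** Transport along [t |-> c - t].  For the integral formula, the scalar measure
    of [x] has total mass [ip x x] and is supported in a bounded interval, so that
    integrating [c - t] against it splits into [c * ip x x - ip (y x) x]. *)
Lemma spectral_resolution_reflect (c : R) (y : H -> H)
    (E : set (measurableTypeR R) -> H -> H) :
  spectral_resolution ip M y E ->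
  spectral_resolution ip M (scalar_operator H c%:C - y)
    (fun B => E (reflect_line c @^-1` B)).
Proof.
move=> hE; have [r Er] := resolution_compact hE; rewrite -/(K r) in Er.
have mrefl := @measurable_reflect_preimage R c.
split.
- by move=> B /mrefl; exact: (resolution_mem hE).
- by move=> B /mrefl; exact: (resolution_hermitian hE).
- by move=> B C /mrefl mB /mrefl mC; rewrite preimage_setI (resolution_mul hE).
- by rewrite preimage_setT (resolution_unit hE).
- (* [E] is the identity on every set that contains [- r, r], and
     [c - t] lies in [- (|c| + r), |c| + r] for such [t]. *)
  exists (`|c| + r); rewrite -/(K (`|c| + r)).
  have KK : K r `&` reflect_line c @^-1` K (`|c| + r) = K r.
    apply/setIidPl => t; rewrite /K /reflect_line /= => /andP[t1 t2].
    have := ler_norm c; have := ler_norm (- c); rewrite normrN => c1 c2.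
    by apply/andP; split; lra.
  have := resolution_mul hE (measurable_K r) (mrefl _ (measurable_K (`|c| + r))).
  by rewrite KK Er.
- move=> x; have [m [mE yE]] := resolution_integral hE x.
  have mT : (fine (m setT))%:C = ip x x.
    rewrite mE // (resolution_unit hE) /= RRe_real // hH.
    by rewrite realX // normr_real.
  have m0 : m (~` K r) = 0%E.
    have mKC : measurable (~` K r) by exact: measurableC.
    (* [E] is the identity on [K r], hence [E (~` K r) = E set0]. *)
    have := resolution_mul hE (measurable_K r) mKC.
    rewrite setICr Er -[idfun \o _]/(E (~` K r)) => EKC.
    by rewrite mE // -EKC -mE.
  exists (reflected_measure c m); split.
    by move=> B mB; rewrite -mE //; exact: mrefl.
  rewrite Rintegral_reflected_measure; last first.
    exact: integrable_id_bounded_support m0.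
  rewrite scalar_sub_apply linearBl linearZl_LR.
  by rewrite rmorphB rmorphM /= mT; congr (_ - _).
Qed.

Lemma two_atoms_reflect (a x x' : R) (B : set (measurableTypeR R)) :
  two_atoms a x x' (reflect_line (x + x') @^-1` B) = two_atoms (1 - a) x x' B.
Proof.
have mem t : (t \in reflect_line (x + x') @^-1` B) = (x + x' - t \in B).
  by [].
rewrite /two_atoms !diracE !mem subKr addeC.
by rewrite addrK [x + x']addrC addrK.
Qed.

Lemma spectral_law_reflect (tau : (H -> H) -> R[i]) (y : H -> H) (a x x' : R) :
  spectral_law ip M tau y (two_atoms a x x') ->
  spectral_law ip M tau (scalar_operator H (x + x')%:C - y)
    (two_atoms (1 - a) x x').
Proof.
move=> [E [hE tauE]]; exists (fun B => E (reflect_line (x + x') @^-1` B)).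
split; first exact: spectral_resolution_reflect.
move=> B mB; rewrite -two_atoms_reflect tauE //.
exact: measurable_reflect_preimage.
Qed.

Lemma free_two_atom_pair_sym (tau : (H -> H) -> R[i])
    (a alpha alpha' b beta beta' : R) (p q : H -> H) :
  free_two_atom_pair ip M tau a alpha alpha' b beta beta' p q ->
  free_two_atom_pair ip M tau b beta beta' a alpha alpha' q p.
Proof. by case=> ? ? ? ? /freely_independent_sym ? ? ?; split. Qed.

Lemma free_two_atom_pair_reflect (tau : (H -> H) -> R[i])
    (a alpha alpha' b beta beta' : R) (p q : H -> H) :
  free_two_atom_pair ip M tau a alpha alpha' b beta beta' p q ->
  free_two_atom_pair ip M tau (1 - a) alpha alpha' b beta beta'
    (scalar_operator H (alpha + alpha')%:C - p) q.
Proof.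
case=> Mp Mq hp hq fpq lp lq; split => //.
- exact: vna_scalar_sub hM Mp.
- exact: hermitian_scalar_sub.
- rewrite /freely_independent; set A := (A in free_subalgebras _ A).
  have -> : A = fun i : bool => generated_star_algebra ip (if i then p else q).
    by apply/funext => -[] //; exact: generated_scalar_sub.
  exact: fpq.
- exact: spectral_law_reflect.
Qed.

End ReflectedLaw.

(** * The symmetries of the angular measure *)

Section AngularMeasure.
Variable R : realType.
Implicit Types a b x y theta : R.

Lemma nu_f_sym a b : nu_f b a = nu_f a b.
Proof. by apply/funext => x; rewrite /nu_f; ring. Qed.

Lemma nu_f_inv a b x : x != 0 ->
  x ^+ 2 * nu_f a b x^-1 =
  x ^+ 2 + (4 * a * b - 2 * (a + b)) * x + (a - b) ^+ 2.
Proof. by move=> x0; rewrite /nu_f; field. Qed.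

Lemma nu_f_flip a b x y : x != 0 -> y != 0 -> x + y = 1 ->
  x ^+ 2 * nu_f (1 - a) b x^-1 = y ^+ 2 * nu_f a b y^-1.
Proof.
move=> x0 y0 xy; rewrite !nu_f_inv //.
have -> : y = 1 - x by rewrite -xy addrC addKr.
by ring.
Qed.

Lemma nu_f_flip2 a b : nu_f (1 - a) (1 - b) = nu_f a b.
Proof. by apply/funext => x; rewrite /nu_f; ring. Qed.

Lemma nu_epsilon_sym a b : nu_epsilon b a = nu_epsilon a b.
Proof.
rewrite /nu_epsilon (_ : b + a - 1 = a + b - 1); last by ring.
rewrite (_ : b + (1 - a) - 1 = 1 - a + b - 1); last by ring.
rewrite (_ : 1 - b + a - 1 = a + (1 - b) - 1); last by ring.
rewrite (_ : 1 - b + (1 - a) - 1 = 1 - a + (1 - b) - 1); last by ring.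
by rewrite [X in X - _ = _]addrAC.
Qed.

Lemma nu_epsilon_flip a b : nu_epsilon (1 - a) b = nu_epsilon a b.
Proof. by rewrite /nu_epsilon subKr; ring. Qed.

(** The four maxima add up to [`|a + b - 1| + `|a - b|], which is the larger of
    [`|2 * a - 1|] and [`|2 * b - 1|]. *)
Lemma nu_epsilon_ge0 a b : 0 < a < 1 -> 0 < b < 1 -> 0 <= nu_epsilon a b.
Proof.
move=> /andP[? ?] /andP[? ?]; rewrite /nu_epsilon.
case: (leP 0 (a + b - 1)) => ?; case: (leP 0 (a + (1 - b) - 1)) => ?;
by case: (leP 0 (1 - a + b - 1)) => ?;
   case: (leP 0 (1 - a + (1 - b) - 1)) => ?; lra.
Qed.

(** The real square root vanishes on the negative half-line, so a single formula
    covers both signs of [x]; it makes the density visibly continuous. *)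
Lemma Im_sqrtc_real x : complex.Im (sqrtc x%:C) = Num.sqrt (- x).
Proof.
rewrite /= eqxx mul1r expr0n /= addr0 sqrtr_sqr; case: ger0P => x0.
  by rewrite subrr mul0r sqrtr0 ler0_sqrtr // oppr_le0.
by congr Num.sqrt; field.
Qed.

Lemma sqrt_opp_scale x y :
  0 <= x -> Num.sqrt (- (x ^+ 2 * y)) = x * Num.sqrt (- y).
Proof.
by move=> x0; rewrite -mulrN sqrtrM ?sqr_ge0 // sqrtr_sqr ger0_norm.
Qed.

Lemma nu_densityE a b theta :
  nu_density a b theta = 2 / (pi * nu_epsilon a b)
    * Num.sqrt (- nu_f a b (cos theta ^+ 2)^-1) * (cos theta / sin theta).
Proof. by rewrite /nu_density Im_sqrtc_real exprVn. Qed.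

Lemma cos_pihalfB theta : cos (pi / 2 - theta) = sin theta.
Proof. by rewrite cosB cos_pihalf sin_pihalf mul0r add0r mul1r. Qed.

Lemma sin_pihalfB theta : sin (pi / 2 - theta) = cos theta.
Proof. by rewrite sinB cos_pihalf sin_pihalf mul0r subr0 mul1r. Qed.

Lemma cos_gt0_quadrant theta : 0 < theta < pi / 2 -> 0 < cos theta.
Proof. by move=> tI; rewrite -sin_pihalfB sin_gt0_pihalf //; lra. Qed.

Lemma nu_density_flip a b theta : 0 < theta < pi / 2 ->
  nu_density (1 - a) b theta = nu_density a b (pi / 2 - theta).
Proof.
move=> tI; rewrite !nu_densityE nu_epsilon_flip cos_pihalfB sin_pihalfB.
have s0 := sin_gt0_pihalf tI; have c0 := cos_gt0_quadrant tI.
have c20 := lt0r_neq0 (exprn_gt0 2 c0).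
have := nu_f_flip a b c20 (lt0r_neq0 (exprn_gt0 2 s0)) (cos2Dsin2 theta).
move=> /(congr1 (fun u => Num.sqrt (- u))).
rewrite !sqrt_opp_scale ?sqr_ge0 // => e.
set k := 2 / _; rewrite -2![k * _ * _]mulrA; congr (k * _).
apply: (mulfI c20); rewrite mulrA e.
by field; rewrite !gt_eqF.
Qed.

Lemma nu_density_ge0 a b theta :
  0 < a < 1 -> 0 < b < 1 -> 0 < theta < pi / 2 -> 0 <= nu_density a b theta.
Proof.
move=> ha hb tI; rewrite nu_densityE.
have s0 := sin_gt0_pihalf tI; have c0 := cos_gt0_quadrant tI.
by rewrite !(mulr_ge0, divr_ge0, sqrtr_ge0, invr_ge0, pi_ge0, nu_epsilon_ge0) //
  ltW.
Qed.

Lemma measurable_nu_density a b :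
  measurable_fun (`]0, (pi / 2)[%classic : set (measurableTypeR R))
    (nu_density a b).
Proof.
apply: open_continuous_measurable_fun; first exact: interval_open.
move=> x; rewrite inE /= in_itv /= => xI.
have s0 := sin_gt0_pihalf xI; have c0 := cos_gt0_quadrant xI.
rewrite (funext (nu_densityE a b)).
have cV : {for x, continuous (fun y : R => (cos y ^+ 2)^-1)}.
  apply: continuousV; first by rewrite expf_neq0 // gt_eqF.
  by apply: cvgM; exact: continuous_cos.
apply: cvgM; last first.
  apply: cvgM; first exact: continuous_cos.
  by apply: cvgV; [rewrite gt_eqF | exact: continuous_sin].
apply: cvgM; first exact: cvg_cst.
apply: (@continuous_comp _ _ _ (fun y => - nu_f a b (cos y ^+ 2)^-1)
  (@Num.sqrt R)); last exact: sqrt_continuous.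
apply: cvgN; rewrite /nu_f; apply: cvgD.
  by apply: cvgD; [exact: cvg_cst | apply: cvgM; [exact: cvg_cst | exact: cV]].
by apply: cvgM; [exact: cvg_cst | exact: (cvgM cV cV)].
Qed.

Lemma nu_sym a b : nu b a = nu a b.
Proof.
apply/funext => B; rewrite /nu; apply: eq_integral => t _.
by rewrite /nu_density nu_f_sym nu_epsilon_sym.
Qed.

Lemma nu_flip2 a b : nu (1 - a) (1 - b) = nu a b.
Proof.
apply/funext => B; rewrite /nu; apply: eq_integral => t _.
rewrite /nu_density nu_f_flip2 nu_epsilon_flip.
by rewrite nu_epsilon_sym nu_epsilon_flip nu_epsilon_sym.
Qed.

Lemma nu_flip a b (B : set (measurableTypeR R)) :
  0 < a < 1 -> 0 < b < 1 -> measurable B ->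
  nu (1 - a) b B = pushforward (nu a b) (@reflect_angle R) B.
Proof.
move=> ha hb mB; rewrite /pushforward /nu.
have -> : @reflect_angle R = reflect_line (pi / 2) by [].
set I := `]0, (pi / 2)[%classic; set D := reflect_line (pi / 2) @^-1` B `&` I.
have IE t : I t <-> 0 < t < pi / 2 by rewrite /I /= in_itv.
have mI : measurable (I : set (measurableTypeR R)) by exact: measurable_itv.
rewrite -(@ge0_integral_reflect R (pi / 2) D (fun t => (nu_density a b t)%:E)).
- have -> : reflect_line (pi / 2) @^-1` D = B `&` I.
    apply/seteqP; split => t [Bt /IE It]; split.
    + by rewrite -(reflect_lineK (pi / 2) t).
    + by apply/IE; move: It; rewrite /reflect_line; lra.
    + by rewrite -(reflect_lineK (pi / 2) t) in Bt.
    + by apply/IE; rewrite /reflect_line; lra.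
  apply: eq_integral => t; rewrite inE => -[_ /IE tI].
  by rewrite nu_density_flip.
- by apply: measurableI => //; exact: measurable_reflect_preimage.
- apply/measurable_EFinP.
  apply: measurable_funS mI _ (measurable_nu_density a b).
  exact: subIsetr.
- by move=> t [_ /IE tI]; rewrite lee_fin nu_density_ge0.
Qed.

End AngularMeasure.

(** * Effect of the reflections on the pair and on its angular measure *)

Theorem corollary6p4 (R : realType) (H : completeNormedModType R[i])
    (ip : {dot H for Num.conj}) (M : set (H -> H)) (tau : (H -> H) -> R[i])
    (p q : H -> H) (a b alpha alpha' beta beta' : R)
    (hH : hilbert_inner_product ip)
    (hM : von_neumann_algebra ip M)
    (htau : faithful_normal_tracial_state ip M tau)
    (ha : 0 < a < 1) (hb : 0 < b < 1)
    (halpha : alpha <> alpha') (hbeta : beta <> beta')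
    (hpq : free_two_atom_pair ip M tau a alpha alpha' b beta beta' p q) :
  let p' : H -> H := scalar_operator H (alpha + alpha')%:C - p in
  let q' : H -> H := scalar_operator H (beta + beta')%:C - q in
  (forall B, measurable B -> nu b a B = nu a b B)
  /\ ((forall B, measurable B ->
         nu (1 - a) b B = pushforward (nu a b) (@reflect_angle R) B)
      /\ (forall B, measurable B ->
         nu a (1 - b) B = pushforward (nu a b) (@reflect_angle R) B)
      /\ free_two_atom_pair ip M tau
           (1 - a) alpha alpha' b beta beta' p' q
      /\ free_two_atom_pair ip M tau
           a alpha alpha' (1 - b) beta beta' p q')
  /\ ((forall B, measurable B -> nu (1 - a) (1 - b) B = nu a b B)
      /\ free_two_atom_pair ip M tau
           (1 - a) alpha alpha' (1 - b) beta beta' p' q'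
      /\ p' + 'i *: q' =
         scalar_operator H ((alpha + alpha')%:C + 'i * (beta + beta')%:C)
         - (p + 'i *: q)).
Proof.
move=> p' q'.
have flip_p := free_two_atom_pair_reflect hH hM hpq.
have flip_q : free_two_atom_pair ip M tau
    a alpha alpha' (1 - b) beta beta' p q'.
  exact/free_two_atom_pair_sym/free_two_atom_pair_reflect/
    free_two_atom_pair_sym.
split; first by move=> B _; rewrite nu_sym.
split.
  split; first by move=> B mB; exact: nu_flip.
  split; last by [].
  by move=> B mB; rewrite nu_sym nu_flip // nu_sym.
split; first by move=> B _; rewrite nu_flip2.
split; first exact: free_two_atom_pair_reflect flip_q.
rewrite /p' /q' /scalar_operator scalerDl scalerBr scalerA.
by rewrite opprD addrACA.
Qed.
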